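(* Let $n\ge 1$. For $0<h<1$ let $\mathcal{T}(h)=h^{2}\sum_{\vec{j}\in\mathbb{Z}^n}h^n\delta_{h\vec{j}}$ (a measure on $\mathbb{R}^n$) and $\mathcal{S}(h)=\sum_{\vec{k}\in\mathbb{Z}^n}\sum_{\{\vec{j}\in\mathbb{Z}^n:\,|\vec{j}-\vec{k}|=1\}}h^n\,\delta_{(h\vec{k},h\vec{j})}$ (a measure on $\mathbb{R}^n\times\mathbb{R}^n$). Let $\Phi\in\mathscr{C}^2(\mathbb{R}^n\times\mathbb{R}^n)$ with $\Phi(x,x)=0$ for all $x\in\mathbb{R}^n$. For each $h$, let $\psi_h:h\mathbb{Z}^n\to\mathbb{R}$ be the function satisfying $$\int_{\mathbb{R}^n}\varphi\,\psi_h\,d\mathcal{T}(h)=\iint_{\mathbb{R}^n\times\mathbb{R}^n}\varphi(x)\Phi(x,y)\,d\mathcal{S}(h)(x,y)\quad\text{for all }\varphi\in\mathscr{C}_c(\mathbb{R}^n),$$ and set $\mathcal{Q}(\Phi,h)(x)=\sum_{\vec{k}\in\mathbb{Z}^n}\psi_h(h\vec{k})\,\mathcal{X}_{Q(h\vec{k})}(x)$, where $Q(h\vec{k})=\prod_{m=1}^n[hk_m,h(k_m+1))$. Then for every $\varphi\in\mathscr{C}_c(\mathbb{R}^n)$, $$\lim_{h\to 0^+}\int_{\mathbb{R}^n}\mathcal{Q}(\Phi,h)(x)\varphi(x)\,dx=\int_{\mathbb{R}^n}\Delta_y\Phi(x,x)\,\varphi(x)\,dx,$$ i.e. $\frac{d\mathcal{S}}{d\mathcal{T}}(\Phi)=\Delta_y\Phi(x,x)$.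 Moreover, for $f\in\mathscr{C}^2(\mathbb{R}^n)$ and $\Phi(x,y)=f(y)-f(x)$, $\frac{d\mathcal{S}}{d\mathcal{T}}(\Phi)=\Delta f$.
   Context: $\Delta_y\Phi(x,x)$ denotes $\sum_{i=1}^n\frac{\partial^2\Phi}{\partial y_i^2}$ evaluated at $(x,x)$; $\Delta f=\sum_i\partial^2 f/\partial x_i^2$. $\delta_p$ is the unit point mass at $p$. The derivative $\frac{d\mathcal{S}}{d\mathcal{T}}(\Phi)$ is defined as the limit, as $h\to0^+$, of the quotients $\mathcal{Q}(\Phi,h)$ (the Kirchhoff divergence $\psi_h$ of $\Phi$ with respect to $\mathcal{T}(h),\mathcal{S}(h)$, extended as a piecewise constant function on the cubes $Q(h\vec{k})$), the limit being taken in the sense of distributions, i.e. tested against $\varphi\in\mathscr{C}_c(\mathbb{R}^n)$ with Lebesgue measure; the limit is identified with a function $g$ when $\int \mathcal{Q}(\Phi,h)\varphi\,dx\to\int g\varphi\,dx$ for all such $\varphi$. *)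

(* Defs.v *)
From HB Require Import structures.
From mathcomp Require Import all_boot all_order all_algebra.
From mathcomp Require Import all_classical all_reals all_analysis.
Set Implicit Arguments. Unset Strict Implicit. Unset Printing Implicit Defensive.
Import Order.TTheory GRing.Theory Num.Theory.
Import numFieldNormedType.Exports.
Local Open Scope classical_set_scope.
Local Open Scope ring_scope.

Section Defs.
Variable R : realType.

Definition unitv (m : nat) (i : 'I_m) : 'rV[R]_m := delta_mx 0 i.

Definition partial (m : nat) (f : 'rV[R]_m -> R) (i : 'I_m) : 'rV[R]_m -> R :=
  fun x => derive f x (unitv i).

Definition C2 (m : nat) (f : 'rV[R]_m -> R) : Prop :=
  continuous f /\
  (forall i x, derivable f x (unitv i)) /\
  (forall i, continuous (partial f i)) /\
  (forall i j x, derivable (partial f i) x (unitv j)) /\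
  (forall i j, continuous (partial (partial f i) j)).

Definition uncurry2 (n : nat) (Phi : 'rV[R]_n -> 'rV[R]_n -> R) : 'rV[R]_(n + n) -> R :=
  fun z => Phi (lsubmx z) (rsubmx z).

Definition C2_2 (n : nat) (Phi : 'rV[R]_n -> 'rV[R]_n -> R) : Prop :=
  C2 (uncurry2 Phi).

Definition laplacian (n : nat) (f : 'rV[R]_n -> R) : 'rV[R]_n -> R :=
  fun x => \sum_(i < n) partial (partial f i) i x.

Definition laplacian_y_diag (n : nat) (Phi : 'rV[R]_n -> 'rV[R]_n -> R) : 'rV[R]_n -> R :=
  fun x => laplacian (Phi x) x.

Definition Cc (n : nat) (phi : 'rV[R]_n -> R) : Prop :=
  continuous phi /\ compact (closure (phi @^-1` [set~ 0])).

Definition lat (n : nat) (h : R) (j : 'rV[int]_n) : 'rV[R]_n :=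
  map_mx (fun z : int => h * z%:~R) j.

Definition nbr (n : nat) (k j : 'rV[int]_n) : Prop :=
  \sum_(m < n) (j 0 m - k 0 m) ^+ 2 = 1.

(* integral of phi * psi against T(h) = h^2 sum_{j in Z^n} h^n delta_{hj},
   where psi : h Z^n -> R is encoded as psi j = psi(hj) *)
Definition int_T (n : nat) (h : R) (phi : 'rV[R]_n -> R) (psi : 'rV[int]_n -> R) : R :=
  \sum_(j \in [set: 'rV[int]_n]) h ^+ 2 * h ^+ n * (phi (lat h j) * psi j).

Definition int_S (n : nat) (h : R) (G : 'rV[R]_n -> 'rV[R]_n -> R) : R :=
  \sum_(p \in [set p : 'rV[int]_n * 'rV[int]_n | nbr p.1 p.2])
     h ^+ n * G (lat h p.1) (lat h p.2).

Definition cube (n : nat) (h : R) (k : 'rV[int]_n) : set 'rV[R]_n :=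
  [set x | forall m : 'I_n, h * (k 0 m)%:~R <= x 0 m < h * ((k 0 m)%:~R + 1)].

(* Q(Phi, h)(x) = sum_k psi_h(hk) X_{Q(hk)}(x), psi_h(hk) encoded as psi k *)
Definition Qfun (n : nat) (h : R) (psi : 'rV[int]_n -> R) : 'rV[R]_n -> R :=
  fun x => \sum_(k \in [set: 'rV[int]_n]) psi k * \1_(cube h k) x.

(* Lebesgue integral over R^n, as an iterated integral over R (Fubini) *)
Fixpoint leb_int (n : nat) : ('rV[R]_n -> R) -> R :=
  match n with
  | 0 => fun g => g 0
  | n'.+1 => fun g =>
      (\int[@lebesgue_measure R]_(t in [set: R])
         leb_int (fun y : 'rV[R]_n' => g (row_mx (t%:M : 'rV[R]_1) y)))%R
  end.

End Defs.

(* Main.v *)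
(* Testing the defining identity of psi_h against a bump function concentrated
   at one lattice point gives
     psi_h (hk) = h^-2 * sum_i (Phi (hk, hk + h e_i) + Phi (hk, hk - h e_i)).
   As Phi vanishes on the diagonal, each summand is a second central difference,
   hence h^2 times a value of the second derivative of Phi in y_i within h of
   the diagonal point (hk, hk).  So Q(Phi, h) converges pointwise to
   Delta_y Phi (x, x), and boundedly on the support of the test function;
   dominated convergence concludes.  As the integral over R^n is iterated, the
   dominated convergence is done coordinate by coordinate, and integrability at
   each stage is obtained by approximating Q(Phi, h) phi with functions that are
   constant on the cubes of a finer grid. *)
Require Import Defs.
From HB Require Import structures.
From mathcomp Require Import all_boot all_order all_algebra.
From mathcomp Require Import all_classical all_reals all_analysis.
From mathcomp Require Import measurable_realfun ring lra.
Import Order.TTheory GRing.Theory Num.Theory.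
Import numFieldNormedType.Exports.
Local Open Scope classical_set_scope.
Local Open Scope ring_scope.

Set Implicit Arguments. Unset Strict Implicit. Unset Printing Implicit Defensive.

(** * Iterated Lebesgue integrals *)

Section IteratedIntegral.
Variable R : realType.
Local Notation mu := (@lebesgue_measure R).

Definition slice (n : nat) (g : 'rV[R]_n.+1 -> R) (t : R) : 'rV[R]_n -> R :=
  fun y => g (row_mx (t%:M : 'rV[R]_1) y).

(** Every slice, not just almost every one, is asked to be integrable, so that an induction on [n]
    can be run at each fixed [t]. *)
Fixpoint iter_integrable (n : nat) : ('rV[R]_n -> R) -> Prop :=
  match n with
  | 0 => fun _ => True
  | n'.+1 => fun g =>
      (forall t, iter_integrable (slice g t)) /\
      mu.-integrable [set: R] (EFin \o (fun t => leb_int (slice g t)))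
  end.

(** A bound together with a support box, coordinate by coordinate: this form passes to slices with
    the same [M] and [L]. *)
Definition box_dominated (n : nat) (M L : R) (g : 'rV[R]_n -> R) : Prop :=
  (forall x, `|g x| <= M) /\ (forall (x : 'rV[R]_n) i, L < `|x 0 i| -> g x = 0).

Lemma slice_coord_head n (t : R) (y : 'rV[R]_n) :
  (row_mx (t%:M : 'rV[R]_1) y : 'rV_(1 + n)) 0 ord0 = t.
Proof.
have -> : ord0 = lshift n (0 : 'I_1) :> 'I_(1 + n) by exact: val_inj.
by rewrite row_mxEl mxE.
Qed.

Lemma slice_coord_tail n (t : R) (y : 'rV[R]_n) (i : 'I_n) :
  (row_mx (t%:M : 'rV[R]_1) y : 'rV_(1 + n)) 0 (rshift 1 i) = y 0 i.
Proof. by rewrite row_mxEr. Qed.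

Lemma box_dominated_slice n M L (g : 'rV[R]_n.+1 -> R) t :
  box_dominated M L g -> box_dominated M L (slice g t).
Proof.
move=> [gM g0]; split=> [y|y i yi]; first exact: gM.
by apply: (g0 _ (rshift 1 i)); rewrite slice_coord_tail.
Qed.

Lemma leb_int0 n : leb_int (fun _ : 'rV[R]_n => 0) = 0.
Proof.
elim: n => [//|n IH] /=.
under eq_Rintegral do rewrite IH.
by rewrite Rintegral_cst// mul0r.
Qed.

Lemma indic_itvE (L t : R) : \1_(`[- L, L]%classic) t = (`|t| <= L)%R%:R :> R.
Proof. by rewrite indicE mem_setE in_itv /= ler_norml. Qed.

Lemma integrable_indic_sym (C L : R) :
  mu.-integrable [set: R] (EFin \o (fun t => C * \1_(`[- L, L]%classic) t)).
Proof.
have := integrableZl measurableT C (integrable_indic_itv (- L) L true false).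
by apply: eq_integrable => //= t _; rewrite EFinM.
Qed.

Lemma Rintegral_indic_sym (C L : R) : 0 <= L ->
  \int[mu]_t (C * \1_(`[- L, L]%classic) t) = C * (2 * L).
Proof.
move=> L0.
rewrite RintegralZl //; last first.
  exact: (integrable_indic_itv (- L) L true false).
rewrite /Rintegral integral_indic// setIT.
have mE : lebesgue_measure (`[- L, L]%classic : set R) = (2 * L)%:E.
  rewrite lebesgue_measure_itv /= lte_fin; case: (ltrP (- L) L) => h.
    by rewrite -EFinD; congr EFin; lra.
  by congr EFin; lra.
by rewrite -[2 * L]/(fine (2 * L)%:E) -mE.
Qed.

Lemma integrable_box (f : R -> R) (C L : R) : measurable_fun setT f ->
  (forall t, `|f t| <= C * \1_(`[- L, L]%classic) t) ->
  mu.-integrable [set: R] (EFin \o f).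
Proof.
move=> mf fC; apply: le_integrable (integrable_indic_sym C L) => //.
  exact/measurable_EFinP.
by move=> t _ /=; rewrite lee_fin (le_trans (fC t)) ?ler_norm.
Qed.

Lemma Rintegral_box (f : R -> R) (C L : R) : 0 <= L ->
  mu.-integrable [set: R] (EFin \o f) ->
  (forall t, `|f t| <= C * \1_(`[- L, L]%classic) t) ->
  `|\int[mu]_t f t| <= C * (2 * L).
Proof.
move=> L0 fi fC; apply: (le_trans (le_normr_Rintegral _ fi)) => //.
rewrite -Rintegral_indic_sym//; apply: le_Rintegral => //.
  exact: (eq_integrable measurableT _ _ _ (integrable_abse fi)).
exact: integrable_indic_sym.
Qed.

(** For [t] outside [[-L, L]] the slice is identically zero, so a uniform bound on the inner
    integrals becomes an integrable majorant. *)
Lemma slice_box n M L C (g : 'rV[R]_n.+1 -> R) : box_dominated M L g ->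
  (forall t, `|leb_int (slice g t)| <= C) ->
  forall t, `|leb_int (slice g t)| <= C * \1_(`[- L, L]%classic) t.
Proof.
move=> [_ g0] gC t; rewrite indic_itvE.
have [_|h] := lerP `|t| L; first by rewrite mulr1.
rewrite (_ : slice g t = fun=> 0) ?leb_int0 ?normr0 ?mulr0//.
by apply/funext => y; apply: (g0 _ ord0); rewrite slice_coord_head.
Qed.

(** Each coordinate contributes the length [2 * L] of its side of the box. *)
Lemma leb_int_bound n M L (g : 'rV[R]_n -> R) : 0 <= L ->
  iter_integrable g -> box_dominated M L g ->
  `|leb_int g| <= M * (2 * L) ^+ n.
Proof.
move=> L0; elim: n g => [|n IH] g; first by move=> _ [gM _]; rewrite expr0 mulr1; exact: gM.
move=> [gs gi] gd; rewrite exprSr [_ * (_ ^+ n * _)]mulrA.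
apply: (@Rintegral_box (fun t => leb_int (slice g t))) => //.
apply: (slice_box gd) => t.
by apply: IH; [exact: gs|exact: box_dominated_slice].
Qed.

(* Dominated convergence, applied one coordinate at a time: the measurability
   of the inner integral of [g] is inherited from the [g_ j]. *)
Lemma iter_dominated_cvg n M L (g_ : nat -> 'rV[R]_n -> R) (g : 'rV[R]_n -> R) :
  0 <= L -> (forall j, iter_integrable (g_ j)) ->
  (forall j, box_dominated M L (g_ j)) ->
  (forall x, g_ j x @[j --> \oo] --> g x) ->
  iter_integrable g /\ leb_int (g_ j) @[j --> \oo] --> leb_int g.
Proof.
move=> L0; elim: n g_ g => [|n IH] g_ g gi gd gc; first by split; last exact: gc.
have IHt t := IH (fun j => slice (g_ j) t) (slice g t) (fun j => (gi j).1 t)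
  (fun j => box_dominated_slice t (gd j)) (fun y => gc _).
have mf j : measurable_fun setT (fun t => leb_int (slice (g_ j) t)).
  by apply/measurable_EFinP; case: (gi j) => _ /integrableP[].
have mg : measurable_fun setT (fun t => leb_int (slice g t)).
  by apply: (measurable_fun_cvg mf) => t _; exact: (IHt t).2.
have dom j t : `|leb_int (slice (g_ j) t)| <=
    M * (2 * L) ^+ n * \1_(`[- L, L]%classic) t.
  apply: (slice_box (gd j)) => {}t.
  apply: leb_int_bound; [by []|exact: (gi j).1|exact: (box_dominated_slice t (gd j))].
have [] := @dominated_convergence _ _ _ mu _ measurableT
  (fun j t => (leb_int (slice (g_ j) t))%:E) (fun t => (leb_int (slice g t))%:E)
  (fun t => (M * (2 * L) ^+ n * \1_(`[- L, L]%classic) t)%:E).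
- by move=> j; exact: ((measurable_EFinP _ _).2 (mf j)).
- exact: ((measurable_EFinP _ _).2 mg).
- by apply: aeW => t _; apply: cvg_EFin; [exact: nearW|exact: (IHt t).2].
- exact: integrable_indic_sym.
- by apply: aeW => t j _; rewrite lee_fin.
move=> ig _ cg; split; first by split=> // t; exact: (IHt t).1.
rewrite /= /Rintegral; apply: fine_cvg.
by rewrite fineK//; exact: integrable_fin_num.
Qed.

(** * Functions constant on the cubes of a grid *)

Definition gridpt (n : nat) (a : R) (x : 'rV[R]_n) : 'rV[int]_n :=
  map_mx (fun t => Num.floor (a^-1 * t)) x.

(** The preimage of any set is a countable union of half-open intervals of length [a], so [H] may be
    arbitrary. *)
Lemma measurable_floor_comp (a : R) (H : int -> R) : 0 < a ->
  measurable_fun setT (fun t : R => H (Num.floor (a^-1 * t))).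
Proof.
move=> a0 _ Y mY; rewrite setTI.
rewrite (_ : _ @^-1` Y = \bigcup_(z : int)
   (if `[< Y (H z) >] then `[a * z%:~R, a * (z + 1)%:~R[%classic else set0)).
  apply: countable_bigcupT_measurable => // z.
  by case: asboolP => // _; exact: measurable_itv.
apply/seteqP; split=> t /=.
  move=> Yt; exists (Num.floor (a^-1 * t)) => //; rewrite asboolT//= in_itv/=.
  have := floor_itv (a^-1 * t); set z := Num.floor _.
  by rewrite ![a * _]mulrC -ler_pdivlMr// -ltr_pdivrMr// [t / a]mulrC.
move=> [z _]; case: asboolP => //= Yz; rewrite in_itv/= => /andP[h1 h2].
rewrite (@floor_def _ _ z)//.
by rewrite [a^-1 * t]mulrC ler_pdivlMr// ltr_pdivrMr// ![_ * a]mulrC h1.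
Qed.

Lemma gridpt_row_mx n a t (y : 'rV[R]_n) :
  gridpt a (row_mx (t%:M : 'rV[R]_1) y : 'rV_(1 + n)) =
  row_mx ((Num.floor (a^-1 * t))%:M : 'rV[int]_1) (gridpt a y).
Proof.
rewrite /gridpt map_row_mx; congr row_mx.
by apply/rowP => i; rewrite !mxE !ord1.
Qed.

(** A slice of a grid function is again a grid function, and its integral depends on [t] only
    through the floor of [t / a], which makes it measurable. *)
Lemma iter_integrable_grid n (a M L : R) (G : 'rV[int]_n -> R) :
  0 < a -> 0 <= L -> box_dominated M L (fun x => G (gridpt a x)) ->
  iter_integrable (fun x => G (gridpt a x)).
Proof.
move=> a0 L0; elim: n G => [//|n IH] G gd.
pose Gs (z : int) (k : 'rV[int]_n) := G (row_mx (z%:M : 'rV[int]_1) k).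
have sE t : slice (fun x => G (gridpt a x)) t =
    fun y => Gs (Num.floor (a^-1 * t)) (gridpt a y).
  by apply/funext => y; rewrite /slice gridpt_row_mx.
have gs t : iter_integrable (slice (fun x => G (gridpt a x)) t).
  by rewrite sE; apply: IH; rewrite -sE; exact: box_dominated_slice.
split=> //.
apply: (@integrable_box _ (M * (2 * L) ^+ n) L).
  have -> : (fun t => leb_int (slice (fun x => G (gridpt a x)) t)) =
      fun t => (fun z => leb_int (fun y => Gs z (gridpt a y)))
                 (Num.floor (a^-1 * t)).
    by apply/funext => t; rewrite sE.
  exact: (measurable_floor_comp
    (fun z => leb_int (fun y => Gs z (gridpt a y))) a0).
apply: (slice_box gd) => t; by apply: leb_int_bound => //; apply: box_dominated_slice.
Qed.

End IteratedIntegral.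

(** * The lattice and the Kirchhoff divergence *)

Section Lattice.
Variables (R : realType) (n : nat).
Implicit Types (h : R) (x : 'rV[R]_n) (k j : 'rV[int]_n).

Lemma coord_le_norm x i : `|x 0 i| <= `|x|.
Proof.
rewrite [leRHS]/Num.Def.normr /= mx_normrE; apply/bigmax_geP; right => /=.
by exists (0, i).
Qed.

Lemma Cc_box_dominated (phi : 'rV[R]_n -> R) : Cc phi ->
  exists M L, [/\ 0 <= M, 0 <= L & box_dominated M L phi].
Proof.
move=> [cphi cK]; set K := closure _ in cK.
have phi0 x : ~ K x -> phi x = 0.
  by move=> nK; apply: contrapT => px; apply: nK; exact: subset_closure.
have [L [_ KL]] := compact_bounded cK.
have cphiK : compact (phi @` K).
  by apply: continuous_compact => //; exact: continuous_subspaceT.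
have [M [_ KM]] := compact_bounded cphiK.
(* [compact_bounded] gives bounds only by numbers strictly above its constant, whose sign is
   unknown. *)
exists (`|M| + 1), (`|L| + 1); split; rewrite ?addr_ge0//; split.
  move=> x; have [Kx|/phi0 ->] := pselect (K x); last by rewrite normr0 addr_ge0.
  by apply: KM; [rewrite ltr_pwDr// ler_norm|exists x].
move=> x i xi; apply: phi0 => Kx; move: xi; rewrite ltNge => /negP; apply.
apply: (le_trans (coord_le_norm x i)).
by apply: KL => //; rewrite ltr_pwDr// ler_norm.
Qed.

(** A tent of height 1 and sup-norm radius [h]: distinct lattice points are at distance at least
    [h], so it vanishes at all of them but [lat h k]. *)
Definition bump h k x : R := Num.max 0 (1 - h^-1 * `|x - lat h k|).

Lemma bump_lat h k j : 0 < h -> bump h k (lat h j) = (j == k)%:R.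
Proof.
move=> h0; rewrite /bump; case: eqVneq => [->|jk].
  by rewrite subrr normr0 mulr0 subr0; apply/max_idPr; rewrite ler01.
apply/max_idPl; rewrite subr_le0 ler_pdivlMl// mulr1.
have [i ji] : exists i, j 0 i != k 0 i.
  apply/existsP; apply: contraNT jk; rewrite negb_exists => /forallP jk.
  by apply/eqP/rowP => i; apply/eqP; rewrite -[_ == _]negbK.
apply: le_trans (coord_le_norm _ i).
rewrite !mxE -mulrBr normrM gtr0_norm// ler_pMr// -intrB -intr_norm ler1z.
by rewrite -gtz0_ge1 normr_gt0 subr_eq0.
Qed.

Lemma Cc_bump h k : 0 < h -> Cc (bump h k).
Proof.
move=> h0; split.
  apply: (@max_fun_continuous _ _ R (cst 0)
    (fun x => 1 - h^-1 * `|x - lat h k|)) ; [exact: cst_continuous|move=> x].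
  have c1 : `|y - lat h k| @[y --> x] --> `|x - lat h k|.
    exact: cvg_norm (cvgB cvg_id (cvg_cst _)).
  exact: (cvgB (cvg_cst _) (cvgMl_tmp c1)).
have sub : bump h k @^-1` [set~ 0] `<=` [set x | `|x| <= `|lat h k| + h].
  move=> x /= bx; rewrite -lerBlDl; apply: contrapT => /negP; rewrite -ltNge => hx.
  apply: bx; apply/max_idPl; rewrite subr_le0 ler_pdivlMl// mulr1.
  by rewrite (le_trans (ltW hx))// lerB_dist.
have cl : closed [set x : 'rV[R]_n | `|x| <= `|lat h k| + h].
  apply: (@closed_comp _ _ (fun x : 'rV[R]_n => `|x|) [set y | y <= `|lat h k| + h]).
    by move=> x _; exact: norm_continuous.
  exact: closed_le.
apply: bounded_closed_compact; last exact: closed_closure.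
exists (`|lat h k| + h); split=> [|M]; first exact: num_real.
move=> hM x Kx.
apply: le_trans (ltW hM); move/closure_id: cl => cl.
by have := closure_subset sub Kx; rewrite -cl.
Qed.

(** Coordinate and sign ([true] for minus) index the neighbours by a finite type, which turns the
    inner sum of S(h) into an ordinary finite sum. *)
Definition step k (u : 'I_n * bool) : 'rV[int]_n :=
  k + (-1) ^+ u.2 *: delta_mx 0 u.1.

Lemma lat_step h k u :
  lat h (step k u) = lat h k + ((-1) ^+ u.2 * h) *: unitv R u.1.
Proof.
apply/rowP => i; rewrite !mxE; case: u => [m b] /=.
rewrite intrD intrM mulrDr; congr (_ + _).
have -> : ((-1) ^+ b : int)%:~R = (-1) ^+ b :> R by case: b.
by rewrite mulrCA mulrA; case: (_ == _).
Qed.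

(** A nonzero integer square is at least 1, so a sum of integer squares equal to 1 has one term 1
    and all others 0. *)
Lemma nbrE k j : nbr k j <-> exists u, j = step k u.
Proof.
split=> [kj|[[i b] ->]]; last first.
  rewrite /nbr (bigD1 i)//= big1 => [|m mi].
    by rewrite !mxE !eqxx /= mulr1 [k 0 i + _]addrC addrK sqrr_sign addr0.
  by rewrite !mxE (negPf mi) mulr0 addr0 subrr expr0n.
have [i ji] : exists i, j 0 i - k 0 i != 0.
  apply/existsP; apply: contraT; rewrite negb_exists => /forallP jk.
  move: kj; rewrite /nbr big1// => m _.
  by move: (jk m); rewrite negbK => /eqP ->; rewrite expr0n.
have rest0 : 0 <= \sum_(m < n | m != i) (j 0 m - k 0 m) ^+ 2.
  by apply: sumr_ge0 => m _; exact: sqr_ge0.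
move: kj; rewrite /nbr (bigD1 i)//= => kj.
have ji1 : 1 <= (j 0 i - k 0 i) ^+ 2.
  by rewrite -gtz0_ge1 lt_def sqr_ge0 sqrf_eq0 ji.
have r0 : \sum_(m < n | m != i) (j 0 m - k 0 m) ^+ 2 = 0.
  apply: le_anti; rewrite rest0 andbT.
  by rewrite -(lerD2l ((j 0 i - k 0 i) ^+ 2)) kj addr0.
have jk m : m != i -> j 0 m = k 0 m.
  move=> mi; apply/eqP; rewrite -subr_eq0 -sqrf_eq0; apply/eqP.
  by move: r0 => /psumr_eq0P; apply => // l _; exact: sqr_ge0.
have : (j 0 i - k 0 i) ^+ 2 == 1 by rewrite -kj r0 addr0.
rewrite sqrf_eq1 => jiE.
exists (i, j 0 i - k 0 i == -1); apply/rowP => m; rewrite !mxE /=.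
have [->|mi] := eqVneq m i; last by rewrite mulr0 addr0 jk.
rewrite mulr1; case/orP: jiE => /eqP jiE.
  by rewrite jiE /= expr0 -jiE addrC subrK.
by rewrite jiE expr1 -jiE addrC subrK.
Qed.

Lemma step_inj k : injective (step k).
Proof.
move=> [i b] [m c] /addrI /= /rowP e.
have := e i; have := e m; rewrite !mxE !eqxx /= !mulr1.
have [->|im] := eqVneq m i.
  by rewrite !mulr1 => _; case: b {e}; case: c.
by rewrite mulr0 => /esym /eqP; rewrite signr_eq0.
Qed.

(** The bump at [lat h k] leaves only the index [k] in [int_T] and only the pairs [(k, step k u)] in
    [int_S]; the common factor [h ^+ n] then cancels. *)
Lemma kirchhoff_divergenceE h (psi : 'rV[int]_n -> R)
    (Phi : 'rV[R]_n -> 'rV[R]_n -> R) k : 0 < h ->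
  (forall phi, Cc phi ->
     int_T h phi psi = int_S h (fun x y => phi x * Phi x y)) ->
  psi k = h ^- 2 * \sum_u Phi (lat h k) (lat h (step k u)).
Proof.
move=> h0 /(_ _ (Cc_bump k h0)).
rewrite /int_T /int_S.
rewrite -(fsbig_widen [set k]) => [|//|j [_ /= jk]]; last first.
  by rewrite bump_lat// (negPf (_ : j != k)) ?mul0r ?mulr0//; exact/eqP.
rewrite fsbig_set1 bump_lat// eqxx mul1r.
(* [r] lists the neighbour pairs on which the bump does not vanish, without repetition by
   [step_inj]. *)
pose r := [seq (k, step k u) | u <- enum {: 'I_n * bool}].
rewrite -(fsbig_widen [set` r]) => [|p|p [pn pr]]; first last.
- rewrite /= bump_lat//; have [pk|_] := eqVneq p.1 k; last by rewrite mul0r mulr0.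
  case: pr; move: pn; rewrite /= pk => /nbrE[u pu]; apply/mapP; exists u.
    by rewrite mem_enum.
  by rewrite -pu -[in RHS]pk -surjective_pairing.
- by move=> /mapP[u _ ->] /=; apply/nbrE; exists u.
rewrite -fsbig_seq; last first.
  by rewrite map_inj_uniq ?enum_uniq// => u v [/step_inj].
rewrite big_map big_enum /=.
under eq_bigr do rewrite bump_lat// eqxx mul1r.
rewrite -mulr_sumr => E.
have hn : h ^+ n != 0 by rewrite expf_neq0// gt_eqF.
have h2 : h ^+ 2 != 0 by rewrite expf_neq0// gt_eqF.
apply: (mulfI h2); apply: (mulfI hn).
by rewrite mulrA [h ^+ n * h ^+ 2]mulrC E [h ^+ 2 * (_ * _)]mulrA divff// mul1r.
Qed.

Lemma cube_gridpt h k x : 0 < h -> cube h k x <-> k = gridpt h x.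
Proof.
move=> h0; rewrite /cube /=; split=> [xk|-> m].
  apply/rowP => m; rewrite mxE; have /andP[h1 h2] := xk m.
  apply/esym/floor_def.
  by rewrite [h^-1 * _]mulrC ler_pdivlMr// ltr_pdivrMr// ![_ * h]mulrC h1 intrD.
rewrite mxE; have := floor_itv (h^-1 * x 0 m); set z := Num.floor _.
by rewrite intrD ![h * _]mulrC -ler_pdivlMr// -ltr_pdivrMr// [x 0 m / h]mulrC.
Qed.

(** The cubes partition the space, so exactly one indicator is nonzero at [x]. *)
Lemma QfunE h (psi : 'rV[int]_n -> R) x : 0 < h ->
  Qfun h psi x = psi (gridpt h x).
Proof.
move=> h0; rewrite /Qfun -(fsbig_widen [set gridpt h x]) => [|//|k [_ /= kx]].
  rewrite fsbig_set1 indicE mem_set ?mulr1//.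
  exact/(cube_gridpt _ _ h0).
by rewrite indicE memNset ?mulr0// => /(cube_gridpt _ _ h0).
Qed.

Lemma lat_gridpt_le h x i : 0 < h ->
  lat h (gridpt h x) 0 i <= x 0 i < lat h (gridpt h x) 0 i + h.
Proof.
move=> h0; rewrite !mxE; have := floor_itv (h^-1 * x 0 i); set z := Num.floor _.
by rewrite -[X in _ < _ + X]mulr1 -mulrDr intrD ![h * _]mulrC -ler_pdivlMr// -ltr_pdivrMr// [x 0 i / h]mulrC.
Qed.

End Lattice.

(** * Second differences *)

Section SecondDifference.
Variable R : realType.

(** Directional derivatives see only increments, so they can be moved between spaces: to a line, to
    one block of a row vector, or past an added constant. *)
Lemma eq_diff_quotient (V W : normedModType R) (f : V -> R) (g : W -> R)
    (a v : V) (b w : W) :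
  (forall h : R, f (h *: v + a) - f a = g (h *: w + b) - g b) ->
  (derivable f a v -> derivable g b w) /\ 'D_v f a = 'D_w g b.
Proof.
move=> fg; have E : (fun h : R => h^-1 *: ((f \o shift a) (h *: v) - f a)) =
    (fun h : R => h^-1 *: ((g \o shift b) (h *: w) - g b)).
  by apply/funext => h; rewrite /= fg.
by rewrite /derivable /derive E.
Qed.

Lemma is_derive_line (V : normedModType R) (f : V -> R) (x v : V) (t : R) :
  derivable f (t *: v + x) v ->
  is_derive t 1 (fun s : R => f (s *: v + x)) ('D_v f (t *: v + x)).
Proof.
have [|fd ->] := @eq_diff_quotient _ _ f (fun s : R => f (s *: v + x))
    (t *: v + x) v t 1.
  by move=> h; rewrite [h *: 1]mulr1 scalerDl addrA.
by move=> /fd gd; exact: DeriveDef gd erefl.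
Qed.

(** Rolle's theorem for the symmetrised function [w] gives [g1 c - g1 (- c) = K * (2 * c)]; the mean
    value theorem for [g1] on [[-c, c]] then gives a point where [g2] equals [K]. *)
Lemma second_difference (g g1 g2 : R -> R) (h : R) : 0 < h ->
  (forall t : R, is_derive t 1 g (g1 t)) -> (forall t : R, is_derive t 1 g1 (g2 t)) ->
  exists2 b, `|b| <= h & g h + g (- h) - 2 * g 0 = h ^+ 2 * g2 b.
Proof.
move=> h0 dg dg1.
(* [K] is chosen so that Rolle's theorem applies to [w] on [0, h]. *)
pose K := (g h + g (- h) - 2 * g 0) / h ^+ 2.
pose w (t : R) := g t + g (- t) - K * t ^+ 2.
have h2 : h != 0 by rewrite gt_eqF.
have dw (t : R) : is_derive t 1 w (g1 t - g1 (- t) - K * (2 * t)).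
  have dgN : is_derive t 1 (fun s : R => g (- s)) (- g1 (- t)).
    have dN : is_derive t 1 (-%R : R -> R) (-1) by exact: is_deriveNid.
    have := @is_derive1_comp _ g (-%R) t (g1 (- t)) (-1).
    by rewrite mulrN1; apply.
  have dX : is_derive t 1 (fun s : R => K * s ^+ 2) (K * (2 * t)).
    have dX := is_deriveZ K (is_deriveX 2 (is_derive_id t (1 : R))).
    have -> : K * (2 * t) = K *: ((2%:R * id t ^+ 2.-1) *: 1).
      by rewrite expr1 [_ *: 1]mulr1.
    exact: dX.
  exact: is_deriveB.
have wh : w 0 = w h.
  by rewrite /w /K oppr0 expr0n /= mulr0 subr0 divfK ?expf_neq0//; ring.
have dw1 (t : R) : derivable w t 1 := @ex_derive _ _ _ _ _ _ _ (dw t).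
have cw : {within `[0, h], continuous w} by apply: derivable_within_continuous.
have [c] := Rolle h0 (fun t _ => dw1 t) cw wh.
rewrite in_itv /= => /andP[c0 ch] dwc.
have Kc : g1 c - g1 (- c) = K * (2 * c).
  apply/eqP; rewrite -subr_eq0.
  by rewrite -(@derive_val _ _ _ _ _ _ _ (dw c)) (@derive_val _ _ _ _ _ _ _ dwc).
have cc : - c < c by rewrite gtrN.
have cg1 : {within `[- c, c], continuous g1}.
  by apply: derivable_within_continuous => t _; exact: (@ex_derive _ _ _ _ _ _ _ (dg1 t)).
have [b] := MVT cc (fun t _ => dg1 t) cg1.
rewrite in_itv /= => /andP[b1 b2]; rewrite Kc => Kb.
exists b; first by rewrite ler_norml; apply/andP; split; lra.
have c2 : 2 * c != 0 by rewrite mulf_neq0// gt_eqF.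
have -> : g2 b = K.
  by apply: (mulIf c2); rewrite Kb; congr (_ * _); ring.
by rewrite /K [RHS]mulrC divfK// expf_neq0.
Qed.

End SecondDifference.

(** * Convergence of the Kirchhoff divergence *)

Section KirchhoffLimit.
Variables (R : realType) (n : nat).
Implicit Types (h : R) (x y : 'rV[R]_n) (k : 'rV[int]_n).

(** Taking a pair as argument allows joint continuity in both variables to be stated. *)
Definition pure_yy (Phi : 'rV[R]_n -> 'rV[R]_n -> R) (i : 'I_n)
    (z : 'rV[R]_n * 'rV[R]_n) : R :=
  partial (partial (Phi z.1) i) i z.2.

(** Common ground of the two claims of the theorem: it follows from [C2_2 Phi], and from [C2 f] when
    [Phi x y] is [f y - f x]. *)
Definition yC2 (Phi : 'rV[R]_n -> 'rV[R]_n -> R) : Prop :=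
  [/\ forall x i y, derivable (Phi x) y (unitv R i),
      forall x i y, derivable (partial (Phi x) i) y (unitv R i) &
      forall i, continuous (pure_yy Phi i)].

Lemma norm_le_coord x (L : R) : 0 <= L -> (forall i, `|x 0 i| <= L) -> `|x| <= L.
Proof.
move=> L0 xL; rewrite [leLHS]/Num.Def.normr /= mx_normrE.
by apply/bigmax_leP; split=> // -[i j] _ /=; rewrite ord1.
Qed.

Lemma norm_unitv (i : 'I_n) : `|unitv R i| <= 1.
Proof.
apply: norm_le_coord => // j; rewrite mxE eqxx /=.
by case: (_ == _); rewrite ?normr1 ?normr0.
Qed.

Lemma dist_lat_gridpt h x : 0 < h -> `|x - lat h (gridpt h x)| <= h.
Proof.
move=> h0; apply: norm_le_coord => [|i]; first exact: ltW.
have /andP[h1 h2] := lat_gridpt_le x i h0.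
rewrite [(x - _) 0 i]mxE [(- lat h _) 0 i]mxE.
by rewrite ler_norml; apply/andP; split; lra.
Qed.

Lemma divergence_mean (Phi : 'rV[R]_n -> 'rV[R]_n -> R) (psi : 'rV[int]_n -> R)
    h k : yC2 Phi -> (forall x, Phi x x = 0) -> 0 < h ->
  (forall phi, Cc phi ->
     int_T h phi psi = int_S h (fun x y => phi x * Phi x y)) ->
  exists y : 'I_n -> 'rV[R]_n, (forall i, `|y i - lat h k| <= h) /\
    psi k = \sum_i pure_yy Phi i (lat h k, y i).
Proof.
move=> [d1 d2 _] Phi0 h0 /(kirchhoff_divergenceE k h0) ->; set x := lat h k.
have mean i : exists y, `|y - x| <= h /\
    Phi x (lat h (step k (i, true))) + Phi x (lat h (step k (i, false))) =
    h ^+ 2 * pure_yy Phi i (x, y).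
  have [b bh E] := @second_difference R
    (fun s => Phi x (s *: unitv R i + x))
    (fun s => partial (Phi x) i (s *: unitv R i + x))
    (fun s => partial (partial (Phi x) i) i (s *: unitv R i + x)) h h0
    (fun t => is_derive_line (d1 x i _)) (fun t => is_derive_line (d2 x i _)).
  exists (b *: unitv R i + x); split.
    rewrite addrK normrZ; apply: le_trans bh.
    by rewrite ler_piMr// norm_unitv.
  (* The middle term of the central difference is [2 * Phi x x], which is zero. *)
  rewrite /pure_yy /= -E scale0r add0r Phi0 mulr0 subr0 !lat_step /= expr0 expr1.
  by rewrite mulN1r mul1r addrC ![_ *: _ + x]addrC.
have [y yP] := choice mean.
exists y; split=> [i|]; first by case: (yP i).
rewrite -(pair_bigA _ (fun i b => Phi x (lat h (step k (i, b))))) /= mulr_sumr.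
apply: eq_bigr => i _; rewrite big_bool /=; case: (yP i) => _ ->.
by rewrite mulKf// expf_neq0// gt_eqF.
Qed.

(** Continuity on a compact product of balls bounds each coordinate [i]; the sum of these bounds
    serves all [i] at once. *)
Lemma pure_yy_bounded (Phi : 'rV[R]_n -> 'rV[R]_n -> R) (L : R) : yC2 Phi ->
  exists2 K, 0 <= K & forall i x y, `|x| <= L -> `|y| <= L ->
    `|pure_yy Phi i (x, y)| <= K.
Proof.
move=> [_ _ Dc].
have cB : compact [set x : 'rV[R]_n | `|x| <= L].
  apply: bounded_closed_compact.
    exists L; split=> [|M hM x /= xL]; first exact: num_real.
    exact: le_trans xL (ltW hM).
  apply: (@closed_comp _ _ (fun x : 'rV[R]_n => `|x|) [set y | y <= L]).
    by move=> x _; exact: norm_continuous.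
  exact: closed_le.
have bound i : exists K, forall x y, `|x| <= L -> `|y| <= L ->
    `|pure_yy Phi i (x, y)| <= K.
  have : compact (pure_yy Phi i @`
      ([set x : 'rV[R]_n | `|x| <= L] `*` [set x : 'rV[R]_n | `|x| <= L])).
    apply: continuous_compact; last exact: compact_setX.
    exact: continuous_subspaceT.
  move=> /compact_bounded[K [_ hK]]; exists (`|K| + 1) => x y xL yL.
  by apply: hK; [rewrite ltr_pwDr// ler_norm|exists (x, y)].
have [K KP] := choice bound.
exists (\sum_i `|K i|) => [|i x y xL yL]; first by apply: sumr_ge0.
apply: le_trans (KP i x y xL yL) _.
by rewrite (bigD1 i)//= (le_trans (ler_norm _))// lerDl sumr_ge0.
Qed.

Variables (Phi : 'rV[R]_n -> 'rV[R]_n -> R) (psi : R -> 'rV[int]_n -> R).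
Hypotheses (Phi2 : yC2 Phi) (Phi0 : forall x, Phi x x = 0).
Hypothesis psiP : forall h, 0 < h < 1 -> forall phi, Cc phi ->
  int_T h phi (psi h) = int_S h (fun x y => phi x * Phi x y).

(** The mean value points are within [h] of the corner of the cube containing [x], and that corner
    is within [h] of [x]; hence [2 * h]. *)
Lemma Qfun_mean h x : 0 < h < 1 -> exists p : 'I_n -> 'rV[R]_n * 'rV[R]_n,
  (forall i, `|(p i).1 - x| <= 2 * h /\ `|(p i).2 - x| <= 2 * h) /\
  Qfun h (psi h) x = \sum_i pure_yy Phi i (p i).
Proof.
move=> h01; have /andP[h0 _] := h01.
have [y [yh yE]] := divergence_mean (gridpt h x) Phi2 Phi0 h0 (psiP h01).
exists (fun i => (lat h (gridpt h x), y i)); split=> [i|]; last by rewrite QfunE.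
have xh := dist_lat_gridpt x h0; split=> /=.
  by rewrite distrC (le_trans xh)// ler_peMl ?ltW// ltr1n.
rewrite -[_ - x](subrKA (lat h (gridpt h x))) (le_trans (ler_normD _ _))//.
by rewrite mulr_natl mulr2n lerD// distrC.
Qed.

(** The mean value points shrink to [(x, x)], where [pure_yy Phi i] is continuous. *)
Lemma Qfun_cvg (u : nat -> R) x : (forall j, 0 < u j < 1) -> u j @[j --> \oo] --> 0 ->
  Qfun (u j) (psi (u j)) x @[j --> \oo] --> laplacian_y_diag Phi x.
Proof.
move=> u01 u0.
have [p pP] := choice (fun j => Qfun_mean x (u01 j)).
rewrite (_ : (fun j => _) = fun j => \sum_i pure_yy Phi i (p j i)); last first.
  by apply/funext => j; case: (pP j).
have near_x (q : nat -> 'rV[R]_n) : (forall j, `|q j - x| <= 2 * u j) ->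
    q j @[j --> \oo] --> x.
  move=> qu; apply/cvgrPdist_le => e e0.
  have e2 : 0 < e / 2 by rewrite divr_gt0.
  move/cvgrPdist_le: u0 => /(_ _ e2); apply: filterS => j.
  rewrite sub0r normrN => uj; rewrite distrC (le_trans (qu j))//.
  by have := ler_norm (u j); lra.
rewrite /laplacian_y_diag /laplacian.
apply: (cvg_big (@add_continuous R^o)) => i _.
have [_ _ Dc] := Phi2.
apply: (cvg_comp (fun j => p j i) (pure_yy Phi i) _ (Dc i (x, x))).
have c1 : (p j i).1 @[j --> \oo] --> x by apply: near_x => j; case: (pP j) => /(_ i)[].
have c2 : (p j i).2 @[j --> \oo] --> x by apply: near_x => j; case: (pP j) => /(_ i)[].
rewrite (_ : (fun j => p j i) = fun j => ((p j i).1, (p j i).2)).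
  exact: cvg_pair c1 c2.
by apply/funext => j; exact: surjective_pairing.
Qed.

Lemma Qfun_dominated (phi : 'rV[R]_n -> R) (M L : R) :
  0 <= M -> 0 <= L -> box_dominated M L phi ->
  exists2 C, 0 <= C & forall h, 0 < h < 1 ->
    box_dominated C L (fun x => Qfun h (psi h) x * phi x).
Proof.
move=> M0 L0 [phiM phi0].
(* For [h < 1] the mean value points are within 2 of [x], and only [x] with [phi x != 0], hence in
   the box of size [L], matter. *)
have [K K0 DK] := pure_yy_bounded (L + 2) Phi2.
exists (n%:R * K * M) => [|h h01]; first by rewrite !mulr_ge0.
split=> [x|x i xi]; last by rewrite (phi0 x i xi) mulr0.
have [px|] := eqVneq (phi x) 0; first by rewrite px mulr0 normr0 !mulr_ge0.
move=> px; rewrite normrM ler_pM//.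
have xL : `|x| <= L.
  apply: norm_le_coord => // i; rewrite leNgt; apply/negP => /phi0 px0.
  by rewrite px0 eqxx in px.
have /andP[h0 h1] := h01.
have [p [px2 ->]] := Qfun_mean x h01.
rewrite (le_trans (ler_norm_sum _ _ _))//.
have -> : n%:R * K = \sum_(i < n) K by rewrite sumr_const card_ord mulr_natl.
have nearL (q : 'rV[R]_n) : `|q - x| <= 2 * h -> `|q| <= L + 2.
  move=> qx; rewrite -[q](subrK x) (le_trans (ler_normD _ _))//.
  by rewrite addrC lerD// (le_trans qx)//; lra.
apply: ler_sum => i _; have [q1 q2] := px2 i.
by rewrite [p i]surjective_pairing; apply: DK; apply: nearL.
Qed.

(** Replacing [x] by the lower corner [s m x] of its cube of side [h / (m + 1)] gives a grid
    function. The factor [Qfun] is unchanged, since [s m x] stays in the same cube of side [h], and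
    [phi (s m x)] tends to [phi x] by continuity. *)
Lemma iter_integrable_Qfun (phi : 'rV[R]_n -> R) (M L h : R) :
  0 < h < 1 -> 0 <= L -> continuous phi ->
  box_dominated M L (fun x => Qfun h (psi h) x * phi x) ->
  iter_integrable (fun x => Qfun h (psi h) x * phi x).
Proof.
move=> /andP[h0 h1] L0 cphi [FM F0].
pose F x := Qfun h (psi h) x * phi x.
pose a (m : nat) : R := h / m.+1%:R.
have a0 m : 0 < a m by rewrite divr_gt0.
have a1 m : a m <= 1.
  by rewrite ler_pdivrMr// mul1r (le_trans (ltW h1))// ler1n.
pose s (m : nat) x := lat (a m) (gridpt (a m) x).
have sx x : s m x @[m --> \oo] --> x.
  apply/cvgrPdist_le => e e0.
  have := @cvg_harmonic R; move/cvgrPdist_le => /(_ _ e0); apply: filterS => m.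
  rewrite sub0r normrN => me; apply: (le_trans (dist_lat_gridpt x (a0 m))).
  by apply: le_trans (le_trans (ler_norm _) me); rewrite /a ler_piMl// ltW.
(* The cubes of side h/(m+1) refine those of side h. *)
have sgrid m x : gridpt h (s m x) = gridpt h x.
  apply/esym; apply/(cube_gridpt _ _ h0) => i.
  have xh := (cube_gridpt (gridpt h x) x h0).2 erefl i.
  have /andP[s1 s2] := lat_gridpt_le x i (a0 m).
  move: xh => /andP[x1 x2]; apply/andP; split; last exact: le_lt_trans x2.
  rewrite /s [lat _ _ 0 i]mxE; set z := gridpt h x 0 i in x1 *.
  (* The lower face of the coarse cube lies on the fine grid, so rounding down cannot cross it. *)
  have az : a m * (z * m.+1%:Z)%:~R = h * z%:~R.
    by rewrite intrM [z%:~R * _]mulrC mulrA divfK// pnatr_eq0.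
  rewrite -az ler_pM2l// ler_int [gridpt (a m) x 0 i]mxE floor_ge_int.
  by rewrite [_ * x 0 i]mulrC ler_pdivlMr// mulrC az.
(* Rounding moves each coordinate by at most [a m <= 1], so the support box grows by at most 1. *)
have Fd m : box_dominated M (L + 1) (fun x => F (s m x)).
  split=> [x|x i xi]; first exact: FM.
  apply: (F0 _ i); rewrite ltNge; apply/negP => si.
  move: xi; rewrite ltNge => /negP; apply.
  rewrite -[x 0 i](subrK (s m x 0 i)) (le_trans (ler_normD _ _))// addrC lerD//.
  have /andP[x1 x2] := lat_gridpt_le x i (a0 m).
  by rewrite /s ger0_norm; have := a1 m; lra.
have L10 : 0 <= L + 1 by rewrite addr_ge0.
apply: (iter_dominated_cvg L10 _ Fd _).1 => [m|x].
  exact: (iter_integrable_grid (G := fun k => F (lat (a m) k)) (a0 m) L10 (Fd m)).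
rewrite /F; under eq_fun do rewrite QfunE// sgrid -(QfunE (psi h) x h0).
by apply: cvgMl_tmp; apply: continuous_cvg => //; exact: cphi.
Qed.

Lemma Qfun_leb_int_cvg (phi : 'rV[R]_n -> R) : Cc phi ->
  (fun h => leb_int (fun x => Qfun h (psi h) x * phi x)) @ 0^'+
    --> leb_int (fun x => laplacian_y_diag Phi x * phi x).
Proof.
move=> cphi; have [M [L [M0 L0 phiML]]] := Cc_box_dominated cphi.
have [C C0 QC] := Qfun_dominated M0 L0 phiML.
apply/cvg_at_rightP => u [u0 ucvg].
have lim01 (v : nat -> R) : (forall j, 0 < v j < 1) -> v j @[j --> \oo] --> 0 ->
    leb_int (fun x => Qfun (v j) (psi (v j)) x * phi x) @[j --> \oo] -->
    leb_int (fun x => laplacian_y_diag Phi x * phi x).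
  move=> v01 v0; apply: (iter_dominated_cvg (M := C) (L := L) L0 _ _ _).2.
  - by move=> j; apply: (iter_integrable_Qfun (v01 j) L0 cphi.1); exact: QC.
  - by move=> j; exact: QC.
  - by move=> x; apply: cvgMr_tmp; exact: Qfun_cvg.
(* The defining identity of [psi h] is available only for [0 < h < 1]; capping the sequence at 1/2
   keeps it there and changes only finitely many terms. *)
have v01 j : 0 < Num.min (u j) (1 / 2) < 1.
  by rewrite lt_min u0 /= divr_gt0// gt_min; apply/orP; right; lra.
have ev : \forall j \near \oo, Num.min (u j) (1 / 2) = u j.
  have h2 : 0 < 1 / 2 :> R by lra.
  move/cvgrPdist_le: (ucvg) => /(_ _ h2); apply: filterS => j.
  rewrite sub0r normrN => uj; apply/min_idPl; exact: le_trans (ler_norm _) uj.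
have v0 : Num.min (u j) (1 / 2) @[j --> \oo] --> 0.
  by apply: cvg_trans ucvg; apply: near_eq_cvg; apply: filterS ev.
apply: cvg_trans (lim01 _ v01 v0); apply: near_eq_cvg.
by apply: filterS ev => j /= ->.
Qed.

End KirchhoffLimit.

(** * Regularity in the second variable *)

Section RegularityInY.
Variables (R : realType) (n : nat).

(** Moving the concatenated vector along coordinate [rshift n i] moves [y] alone. *)
Lemma row_mx_quotient (G : 'rV[R]_(n + n) -> R) (x y : 'rV[R]_n) (i : 'I_n) (h : R) :
  G (h *: unitv R (rshift n i) + row_mx x y) = G (row_mx x (h *: unitv R i + y)).
Proof.
congr G; apply/rowP => j; rewrite [LHS]mxE [(h *: unitv R _) _ _]mxE.
have [k ->|k ->] := split_ordP j; rewrite ?row_mxEl ?row_mxEr.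
  by rewrite mxE eq_lrshift andbF mulr0 add0r.
by rewrite !mxE (inj_eq (@rshift_inj _ _)).
Qed.

Lemma derivable_row_mx (G : 'rV[R]_(n + n) -> R) (x y : 'rV[R]_n) (i : 'I_n) :
  derivable G (row_mx x y) (unitv R (rshift n i)) ->
  derivable (fun y => G (row_mx x y)) y (unitv R i).
Proof. by apply: (eq_diff_quotient _).1 => h; rewrite row_mx_quotient. Qed.

Lemma partial_row_mx (G : 'rV[R]_(n + n) -> R) (x : 'rV[R]_n) (i : 'I_n) :
  partial (fun y => G (row_mx x y)) i =
  fun y => partial G (rshift n i) (row_mx x y).
Proof.
apply/funext => y; apply: (eq_diff_quotient _).2 => h.
by rewrite row_mx_quotient.
Qed.

Lemma row_mx_continuous :
  continuous (fun z : 'rV[R]_n * 'rV[R]_n => row_mx z.1 z.2).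
Proof.
move=> [x y]; apply/cvgrPdist_le => e e0.
have /cvgrPdist_le/(_ _ e0) hx : z.1 @[z --> (x, y)] --> x by exact: cvg_fst.
have /cvgrPdist_le/(_ _ e0) hy : z.2 @[z --> (x, y)] --> y by exact: cvg_snd.
apply: filterS2 hx hy => z xz yz /=.
apply: norm_le_coord => [|j]; first exact: ltW.
have [k ->|k ->] := split_ordP j; rewrite opp_row_mx add_row_mx ?row_mxEl ?row_mxEr.
  exact: le_trans (coord_le_norm _ _) xz.
exact: le_trans (coord_le_norm _ _) yz.
Qed.

(** With [x] fixed, the partial derivatives of [Phi x] are those of the uncurried function in its
    last [n] coordinates. *)
Lemma C2_2_yC2 (Phi : 'rV[R]_n -> 'rV[R]_n -> R) : C2_2 Phi -> yC2 Phi.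
Proof.
move=> [_ [d1 [_ [d2 c2]]]]; set G := uncurry2 Phi in d1 d2 c2.
have PhiG x : Phi x = fun y => G (row_mx x y).
  by apply/funext => y; rewrite /G /uncurry2 row_mxKl row_mxKr.
split=> [x i y|x i y|i].
- by rewrite PhiG; exact: derivable_row_mx.
- by rewrite PhiG partial_row_mx; exact: derivable_row_mx.
have -> : pure_yy Phi i = fun z =>
    partial (partial G (rshift n i)) (rshift n i) (row_mx z.1 z.2).
  by apply/funext => -[x y]; rewrite /pure_yy /= PhiG !partial_row_mx.
by move=> z; apply: continuous_comp; [exact: row_mx_continuous|exact: c2].
Qed.

Lemma partial_subr (f : 'rV[R]_n -> R) (c : R) (i : 'I_n) :
  partial (fun y => f y - c) i = partial f i.
Proof.
apply/funext => y; apply: (eq_diff_quotient _).2 => h.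
by rewrite opprB addrA subrK.
Qed.

(** For fixed [x] the term [f x] is a constant, so the derivatives in [y] are those of [f], and
    joint continuity reduces to continuity in the second variable. *)
Lemma C2_sub_yC2 (f : 'rV[R]_n -> R) : C2 f -> yC2 (fun x y => f y - f x).
Proof.
move=> [_ [d1 [_ [d2 c2]]]]; split=> [x i y|x i y|i].
- apply: (eq_diff_quotient _).1 (d1 i y) => h.
  by rewrite opprB addrA subrK.
- by rewrite partial_subr; exact: d2.
have -> : pure_yy (fun x y => f y - f x) i = fun z => partial (partial f i) i z.2.
  by apply/funext => z; rewrite /pure_yy partial_subr.
by move=> z; apply: continuous_comp; [exact: cvg_snd|exact: c2].
Qed.

End RegularityInY.

Unset Implicit Arguments.

Theorem theorem10p2 (R : realType) (n : nat) (hn : (0 < n)%N) :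
  (forall (Phi : 'rV[R]_n -> 'rV[R]_n -> R),
     C2_2 Phi -> (forall x, Phi x x = 0) ->
     forall psi : R -> 'rV[int]_n -> R,
       (forall h : R, 0 < h < 1 -> forall phi : 'rV[R]_n -> R, Cc phi ->
          int_T h phi (psi h)
          = int_S h (fun x y => phi x * Phi x y)) ->
     forall phi : 'rV[R]_n -> R, Cc phi ->
       (fun h => leb_int (fun x => Qfun h (psi h) x * phi x)) @ 0^'+
       --> leb_int (fun x => laplacian_y_diag Phi x * phi x)) /\
  (forall f : 'rV[R]_n -> R, C2 f ->
     forall psi : R -> 'rV[int]_n -> R,
       (forall h : R, 0 < h < 1 -> forall phi : 'rV[R]_n -> R, Cc phi ->
          int_T h phi (psi h)
          = int_S h (fun x y => phi x * (f y - f x))) ->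
     forall phi : 'rV[R]_n -> R, Cc phi ->
       (fun h => leb_int (fun x => Qfun h (psi h) x * phi x)) @ 0^'+
       --> leb_int (fun x => laplacian f x * phi x)).
Proof.
split=> [Phi /C2_2_yC2 Phi2 Phi0|f /C2_sub_yC2 f2] psi psiP phi cphi.
  exact: (Qfun_leb_int_cvg Phi2 Phi0 psiP cphi).
have -> : laplacian f = laplacian_y_diag (fun x y => f y - f x).
  apply/funext => x; apply: eq_bigr => i _.
  by rewrite partial_subr.
by apply: (Qfun_leb_int_cvg f2 _ psiP cphi) => x; rewrite subrr.
Qed.
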